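(* Let $\mathfrak{a}$ be a finite-dimensional simple Lie algebra over $\mathbb{C}$ of rank $n$, and let $\mu(u)=(\mu_1(u),\dots,\mu_n(u))$ be an $n$-tuple of formal series $\mu_i(u)=1+\mu_i^{(0)}u^{-1}+\mu_i^{(1)}u^{-2}+\cdots$ with $\mu_i^{(r)}\in\mathbb{C}$. Let $L(\mu(u))$ be the unique irreducible quotient of the Verma module $M(\mu(u))$ over $\mathrm{Y}(\mathfrak{a})$, regarded as an $\mathfrak{a}$-module. Then all weight subspaces of $L(\mu(u))$ are finite-dimensional if and only if for each $i\in\{1,\dots,n\}$ the series $\mu_i(u)$ is the Laurent expansion at $u=\infty$ of a rational function $P_i(u)/Q_i(u)$, where $P_i(u)$ and $Q_i(u)$ are monic polynomials in $u$ of the same degree.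
   Context: Let $A=(a_{ij})_{i,j=1}^n$ be the Cartan matrix of $\mathfrak{a}$ and let $d_1,\dots,d_n$ be the coprime positive integers such that $DA$ is symmetric, $D=\mathrm{diag}(d_1,\dots,d_n)$. The Yangian $\mathrm{Y}(\mathfrak{a})$ is the associative algebra over $\mathbb{C}$ with generators $e_i^{(r)},h_i^{(r)},f_i^{(r)}$ ($i=1,\dots,n$, $r=0,1,2,\dots$) and defining relations $[h_i^{(r)},h_j^{(s)}]=0$, $[e_i^{(r)},f_j^{(s)}]=\delta_{ij}h_i^{(r+s)}$, $[h_i^{(0)},e_j^{(s)}]=d_ia_{ij}e_j^{(s)}$, $[h_i^{(0)},f_j^{(s)}]=-d_ia_{ij}f_j^{(s)}$, $[h_i^{(r+1)},e_j^{(s)}]-[h_i^{(r)},e_j^{(s+1)}]=\tfrac12 d_ia_{ij}(h_i^{(r)}e_j^{(s)}+e_j^{(s)}h_i^{(r)})$, $[h_i^{(r+1)},f_j^{(s)}]-[h_i^{(r)},f_j^{(s+1)}]=-\tfrac12 d_ia_{ij}(h_i^{(r)}f_j^{(s)}+f_j^{(s)}h_i^{(r)})$, $[e_i^{(r+1)},e_j^{(s)}]-[e_i^{(r)},e_j^{(s+1)}]=\tfrac12 d_ia_{ij}(e_i^{(r)}e_j^{(s)}+e_j^{(s)}e_i^{(r)})$, $[f_i^{(r+1)},f_j^{(s)}]-[f_i^{(r)},f_j^{(s+1)}]=-\tfrac12 d_ia_{ij}(f_i^{(r)}f_j^{(s)}+f_j^{(s)}f_i^{(r)})$, and, for $i\ne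 j$ with $m=1-a_{ij}$, $\mathrm{Sym}\,[e_i^{(r_1)},[e_i^{(r_2)},\dots,[e_i^{(r_m)},e_j^{(s)}]\dots]]=0$ and the same with $f$ in place of $e$, where $\mathrm{Sym}$ denotes symmetrization over $r_1,\dots,r_m$. The subalgebra generated by $e_i^{(0)},h_i^{(0)},f_i^{(0)}$ is identified with $\mathrm{U}(\mathfrak{a})$, with $h_i=h_i^{(0)}$ spanning a Cartan subalgebra $\mathfrak{h}$. The Verma module $M(\mu(u))$ is the quotient of $\mathrm{Y}(\mathfrak{a})$ by the left ideal generated by all $e_i^{(r)}$ and all $h_i^{(r)}-\mu_i^{(r)}$; it has a unique maximal submodule (the sum of all submodules not containing the image $1_\mu$ of $1$), and $L(\mu(u))$ is the quotient by it. A weight subspace of an $\mathfrak{a}$-module $V$ is $V_\eta=\{y\in V: h_iy=\eta_iy,\ i=1,\dots,n\}$ for $\eta\in\mathbb{C}^n$. *)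

(* Defs.v *)
From mathcomp Require Import all_boot all_algebra all_fingroup.
From mathcomp Require Import complex.
From mathcomp Require Import Rstruct.
Set Implicit Arguments. Unset Strict Implicit. Unset Printing Implicit Defensive.
Import GRing.Theory Num.Theory.
Local Open Scope ring_scope.

Definition C : numClosedFieldType := (complex Rdefinitions.R).

Definition gcm n (A : 'M[int]_n) : Prop :=
  (forall i, A i i = 2) /\
  (forall i j, i != j -> A i j <= 0) /\
  (forall i j, A i j = 0 <-> A j i = 0).

Definition indecomposable n (A : 'M[int]_n) : Prop :=
  forall I : {set 'I_n}, I != set0 -> I != setT ->
    exists i j, i \in I /\ j \notin I /\ A i j != 0.

Definition symmetrizer n (A : 'M[int]_n) (d : 'I_n -> nat) : Prop :=
  (forall i, (0 < d i)%N) /\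
  (\big[gcdn/0%N]_(i < n) d i = 1%N) /\
  (forall i j, (d i)%:Z * A i j = (d j)%:Z * A j i).

(* A is the Cartan matrix of a finite-dimensional simple Lie algebra of rank n:
   an indecomposable generalized Cartan matrix of finite type, i.e. whose
   symmetrization DA is positive definite. *)
Definition simple_cartan n (A : 'M[int]_n) (d : 'I_n -> nat) : Prop :=
  (0 < n)%N /\ gcm A /\ indecomposable A /\ symmetrizer A d /\
  (forall x : 'I_n -> rat, (exists i, x i != 0) ->
     0 < \sum_(i < n) \sum_(j < n) x i * ((d i)%:Z * A i j)%:~R * x j).

Section Ops.
Variable V : lmodType C.

Definition lin_op (X : V -> V) : Prop :=
  forall (a : C) (u w : V), X (a *: u + w) = a *: X u + X w.

Definition comm (X Y : V -> V) : V -> V := fun v => X (Y v) - Y (X v).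

Definition nested_comm (Xs : seq (V -> V)) (Y : V -> V) : V -> V :=
  foldr comm Y Xs.

End Ops.

Definition yangian_module n (A : 'M[int]_n) (d : 'I_n -> nat)
    (V : lmodType C) (e h f : 'I_n -> nat -> V -> V) : Prop :=
  let c i j : C := ((d i)%:Z * A i j)%:~R in
  (forall i r, lin_op (e i r) /\ lin_op (h i r) /\ lin_op (f i r)) /\
  (forall i j r s v, comm (h i r) (h j s) v = 0) /\
  (forall i j r s v, comm (e i r) (f j s) v = if i == j then h i (r + s)%N v else 0) /\
  (forall i j s v, comm (h i 0%N) (e j s) v = c i j *: e j s v) /\
  (forall i j s v, comm (h i 0%N) (f j s) v = - (c i j *: f j s v)) /\
  (forall i j r s v,
     comm (h i r.+1) (e j s) v - comm (h i r) (e j s.+1) v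
     = (c i j / 2) *: (h i r (e j s v) + e j s (h i r v))) /\
  (forall i j r s v,
     comm (h i r.+1) (f j s) v - comm (h i r) (f j s.+1) v
     = - ((c i j / 2) *: (h i r (f j s v) + f j s (h i r v)))) /\
  (forall i j r s v,
     comm (e i r.+1) (e j s) v - comm (e i r) (e j s.+1) v
     = (c i j / 2) *: (e i r (e j s v) + e j s (e i r v))) /\
  (forall i j r s v,
     comm (f i r.+1) (f j s) v - comm (f i r) (f j s.+1) v
     = - ((c i j / 2) *: (f i r (f j s v) + f j s (f i r v)))) /\
  (forall i j, i != j ->
     forall (rs : (absz (1 - A i j)).-tuple nat) (s : nat) (v : V),
       \sum_(sigma : 'S_(absz (1 - A i j)))
          nested_comm [seq e i (tnth rs (sigma k)) | k <- enum 'I_(absz (1 - A i j))]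
                      (e j s) v = 0 /\
       \sum_(sigma : 'S_(absz (1 - A i j)))
          nested_comm [seq f i (tnth rs (sigma k)) | k <- enum 'I_(absz (1 - A i j))]
                      (f j s) v = 0).

Definition submodule n (V : lmodType C) (e h f : 'I_n -> nat -> V -> V)
    (W : V -> Prop) : Prop :=
  W 0 /\ (forall (a : C) u w, W u -> W w -> W (a *: u + w)) /\
  (forall i r u, W u -> W (e i r u) /\ W (h i r u) /\ W (f i r u)).

Definition irreducible n (V : lmodType C) (e h f : 'I_n -> nat -> V -> V) : Prop :=
  (exists v : V, v != 0) /\
  forall W, submodule e h f W -> (forall u, W u -> u = 0) \/ (forall u, W u).

Definition highest_weight_vector n (V : lmodType C) (e h : 'I_n -> nat -> V -> V)
    (mu : 'I_n -> nat -> C) (v : V) : Prop :=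
  v != 0 /\ (forall i r, e i r v = 0) /\ (forall i r, h i r v = mu i r *: v).

(* weight subspace V_eta w.r.t. the Cartan subalgebra spanned by h_i = h_i^(0) *)
Definition weight_space n (V : lmodType C) (h : 'I_n -> nat -> V -> V)
    (eta : 'I_n -> C) : V -> Prop :=
  fun y => forall i, h i 0%N y = eta i *: y.

Definition fin_dim (V : lmodType C) (W : V -> Prop) : Prop :=
  exists s : seq V, forall y, W y ->
    exists c : 'I_(size s) -> C, y = \sum_(k < size s) c k *: s`_k.

(* coefficients of mu_i(u) = 1 + mu_i^(0) u^-1 + mu_i^(1) u^-2 + ... :
   mu_series mu i k is the coefficient of u^-k *)
Definition mu_series n (mu : 'I_n -> nat -> C) (i : 'I_n) (k : nat) : C :=
  if k is k'.+1 then mu i k' else 1.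

(* the formal series sum_k c_k u^-k is the Laurent expansion at u = oo of
   P(u)/Q(u), i.e. Q(u) * (sum_k c_k u^-k) = P(u) in C((u^-1)):
   the coefficient of u^m (m >= 0) of the product is P`_m, and
   the coefficient of u^-t (t >= 1) of the product is 0. *)
Definition laurent_expansion (c : nat -> C) (P Q : {poly C}) : Prop :=
  (forall m : nat, P`_m = \sum_(m <= j < size Q) Q`_j * c (j - m)%N) /\
  (forall t : nat, (0 < t)%N -> \sum_(j < size Q) Q`_j * c (j + t)%N = 0).

(* Main.v *)
Require Import Defs.
From mathcomp Require Import all_boot all_algebra all_fingroup.
From Stdlib Require Import Classical.
Import GRing.Theory Num.Theory.
Local Open Scope ring_scope.

(** Let [V_k] be the span of the monomials of length [k] in the [f_i^(r)] applied
    to [v]. A combination of the [h_i^(0)] acts on [V_k] by [lambda - k], so [V]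
    is the direct sum of the [V_k] and each weight space lies in a single one.

    If weight spaces are finite-dimensional, the vectors [f_i^(r) v] are linearly
    dependent; applying [e_i^(s)] turns a dependence into a linear recurrence for
    [mu_i^(r)], i.e. rationality of [mu_i(u)].

    Conversely, by induction on [k], the sequences [h_i^(r)] and [f_i^(r)] of
    operators on [V_k] satisfy linear recurrences in [r]. For [f_i] on [V_k], the
    product of a recurrence for the [h_j] on [V_k] and one for the [f_j] on
    [V_(k-1)] yields vectors of [V_(k+1)] killed by every [e_j^(s)], which vanish
    by irreducibility. For [h_i] on [V_(k+1)], the relation between [h_i^(r)] and
    [f_j^(s)] lets one trade the shift in [s] for the shift in [r]. Hence [V_(k+1)]
    is spanned by finitely many [f_i^(r) V_k] and is finite-dimensional. *)

(** * Linear recurrences as annihilators under the index shift *)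

Section ShiftAction.
Context {K : fieldType} {V : lmodType K}.
Implicit Types (p q : {poly K}) (X : nat -> V).

(* [K['X]] acts on sequences by letting ['X] shift the index; [shiftp p X = 0]
   says that [X] satisfies the linear recurrence with coefficients [p]. *)
Definition shiftp p X (s : nat) : V := \sum_(j < size p) p`_j *: X (j + s)%N.

Lemma shiftp_widen N p X s : (size p <= N)%N ->
  shiftp p X s = \sum_(j < N) p`_j *: X (j + s)%N.
Proof.
move=> le_pN; rewrite /shiftp (big_ord_widen N (fun j => p`_j *: X (j + s)%N) le_pN).
rewrite big_mkcond; apply: eq_bigr => j _; case: ltnP => // le_pj.
by rewrite nth_default // scale0r.
Qed.

Lemma eq_shiftp p X Y s : X =1 Y -> shiftp p X s = shiftp p Y s.
Proof. by move=> eqXY; apply: eq_bigr => j _; rewrite eqXY. Qed.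

Lemma shiftp_eq0 p X s : (forall r, X r = 0) -> shiftp p X s = 0.
Proof. by move=> X0; rewrite /shiftp big1 // => j _; rewrite X0 scaler0. Qed.

Lemma shiftpD p q X s : shiftp (p + q) X s = shiftp p X s + shiftp q X s.
Proof.
pose N := maxn (size p) (size q).
rewrite (shiftp_widen N) ?(leq_trans (size_polyD _ _)) //.
rewrite (shiftp_widen N p) ?leq_maxl // (shiftp_widen N q) ?leq_maxr //.
by rewrite -big_split; apply: eq_bigr => j _; rewrite coefD scalerDl.
Qed.

Lemma shiftpZ a p X s : shiftp (a *: p) X s = a *: shiftp p X s.
Proof.
rewrite (shiftp_widen (size p)) ?size_scale_leq // scaler_sumr.
by apply: eq_bigr => j _; rewrite coefZ scalerA.
Qed.

Lemma shiftpC a X s : shiftp a%:P X s = a *: X s.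
Proof. by rewrite (shiftp_widen 1) ?size_polyC_leq1 // big_ord1 coefC. Qed.

Lemma shiftpMX p X s : shiftp (p * 'X) X s = shiftp p X s.+1.
Proof.
rewrite (shiftp_widen (size p).+1); last first.
  by rewrite (leq_trans (size_polyMleq _ _)) // size_polyX addn2.
rewrite big_ord_recl coefMX scale0r add0r.
by apply: eq_bigr => j _; rewrite coefMX /= addSnnS.
Qed.

Lemma shiftpX X s : shiftp 'X X s = X s.+1.
Proof.
rewrite /shiftp size_polyX 2!big_ord_recl big_ord0 !coefX /=.
by rewrite scale0r scale1r add0r addr0.
Qed.

Lemma shiftpM p q X s : shiftp (p * q) X s = shiftp p (shiftp q X) s.
Proof.
elim/poly_ind: p s => [|p a IHp] s; first by rewrite mul0r /shiftp size_poly0 !big_ord0.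
have -> : (p * 'X + a%:P) * q = p * q * 'X + a *: q.
  by rewrite mulrDl mulrAC mul_polyC.
by rewrite !shiftpD shiftpZ !shiftpMX IHp shiftpC.
Qed.

Lemma shiftpM_eq0 p q X : (forall s, shiftp q X s = 0) ->
  forall s, shiftp (p * q) X s = 0.
Proof. by move=> qX0 s; rewrite shiftpM shiftp_eq0. Qed.

(** Recurrences of a finite family are merged into one by multiplying their polynomials. *)
Lemma shiftp_prod_eq0 (I : finType) (p : I -> {poly K}) i X :
  (forall s, shiftp (p i) X s = 0) -> forall s, shiftp (\prod_j p j) X s = 0.
Proof. by move=> piX0 s; rewrite (bigD1 i) //= mulrC shiftpM_eq0. Qed.

Lemma shiftp_addr p X Y s :
  shiftp p (fun r => X r + Y r) s = shiftp p X s + shiftp p Y s.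
Proof. by rewrite -big_split; apply: eq_bigr => j _; rewrite scalerDr. Qed.

Lemma shiftp_scaler a p X s : shiftp p (fun r => a *: X r) s = a *: shiftp p X s.
Proof. by rewrite scaler_sumr; apply: eq_bigr => j _; rewrite !scalerA mulrC. Qed.

Lemma shiftp_swap p q (X : nat -> nat -> V) r s :
  shiftp p (fun j => shiftp q (X^~ j) r) s = shiftp q (fun i => shiftp p (X i) s) r.
Proof.
rewrite /shiftp; under eq_bigr do rewrite scaler_sumr.
rewrite exchange_big; apply: eq_bigr => i _; rewrite scaler_sumr.
by apply: eq_bigr => j _; rewrite !scalerA mulrC.
Qed.

(* On [Z] the two commuting shifts satisfy [sigma + a = tau], hence
   [p (sigma + a) = p tau]. *)
Lemma shiftp_comp a p (Z : nat -> nat -> V) :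
  (forall r s, Z r.+1 s + a *: Z r s = Z r s.+1) ->
  forall r s, shiftp (p \Po ('X + a%:P)) (Z^~ s) r = shiftp p (Z r) s.
Proof.
move=> ZE; elim/poly_ind: p => [|p b IHp] r s.
  by rewrite comp_poly0 /shiftp size_poly0 !big_ord0.
rewrite comp_poly_MXaddC 2!shiftpD (shiftpM (p \Po _)) !shiftpC shiftpMX -IHp.
congr (_ + _).
by apply: eq_shiftp => t; rewrite shiftpD shiftpX shiftpC ZE.
Qed.

(* If [(sigma - tau + a) X = (sigma - tau - a) Y] with [q(sigma) Y = 0] and
   [p(tau) X = 0], then [q(sigma) p(sigma + a)] annihilates [X]. *)
Lemma shiftp_two_shifts a p q (X Y : nat -> nat -> V) :
  (forall r s, X r.+1 s - X r s.+1 + a *: X r s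
             = Y r.+1 s - Y r s.+1 - a *: Y r s) ->
  (forall r s, shiftp q (Y^~ s) r = 0) -> (forall r s, shiftp p (X r) s = 0) ->
  forall r s, shiftp (q * (p \Po ('X + a%:P))) (X^~ s) r = 0.
Proof.
move=> XY qY pX r s.
(* Applying [q] in the first index kills the [Y] side, so [Z] meets the hypothesis of
   [shiftp_comp]. *)
pose Z t j := shiftp q (X^~ j) t.
have shiftS (U : nat -> nat -> V) t j :
    shiftp q (U^~ j) t.+1 = shiftp q (fun i => U i.+1 j) t.
  by apply: eq_bigr => i _; rewrite addnS.
have shift_comb (U : nat -> nat -> V) b t j :
    shiftp q (fun i => U i.+1 j - U i j.+1 + b *: U i j) t
    = shiftp q (U^~ j) t.+1 - shiftp q (U^~ j.+1) t + b *: shiftp q (U^~ j) t.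
  rewrite !shiftp_addr shiftp_scaler shiftS; congr (_ + _ + _).
  rewrite -scaleN1r -shiftp_scaler.
  by apply: eq_shiftp => i; rewrite scaleN1r.
have ZE t j : Z t.+1 j + a *: Z t j = Z t j.+1.
  apply/eqP; rewrite -subr_eq0 addrAC -shift_comb.
  rewrite (@eq_shiftp _ _ (fun i => Y i.+1 j - Y i j.+1 + (- a) *: Y i j)).
    by rewrite shift_comb !qY scaler0 subrr addr0.
  by move=> i; rewrite XY scaleNr.
by rewrite mulrC shiftpM (shiftp_comp _ _ _ ZE) shiftp_swap shiftp_eq0.
Qed.

End ShiftAction.

(** * Spans, finite dimension and linear dependence *)

Section Span.
Context {V : lmodType C}.
Implicit Types (G W : V -> Prop) (s : seq V).

Inductive span G : V -> Prop :=
| span0 : span G 0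
| span_lin a u w : span G u -> span G w -> span G (a *: u + w)
| span_gen u : G u -> span G u.

Definition subspace W : Prop := W 0 /\ forall a u w, W u -> W w -> W (a *: u + w).

Lemma span_subspace G : subspace (span G).
Proof. by split; [exact: span0 | exact: span_lin]. Qed.

Lemma subspaceZ W a u : subspace W -> W u -> W (a *: u).
Proof. by move=> [W0 WL] Wu; rewrite -[_ *: _]addr0; apply: WL. Qed.

Lemma subspaceD W u w : subspace W -> W u -> W w -> W (u + w).
Proof. by move=> [W0 WL] Wu Ww; rewrite -[u]scale1r; apply: WL. Qed.

Lemma subspaceB W u w : subspace W -> W u -> W w -> W (u - w).
Proof. by move=> [W0 WL] Wu Ww; rewrite addrC -scaleN1r; apply: WL. Qed.

Lemma subspace_sum W (I : Type) (r : seq I) (P : pred I) (x : I -> V) :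
  subspace W -> (forall i, P i -> W (x i)) -> W (\sum_(i <- r | P i) x i).
Proof.
move=> sW Wx; apply: (big_ind W) => //; first by case: sW.
by move=> *; apply: subspaceD.
Qed.

Lemma span_min G W : subspace W -> (forall u, G u -> W u) -> forall u, span G u -> W u.
Proof. by move=> [W0 WL] GW u; elim=> // *; apply: WL. Qed.

Lemma span_seq_comb s y : span (fun u => u \in s) y ->
  exists c : 'I_(size s) -> C, y = \sum_k c k *: s`_k.
Proof.
elim=> [|a u w _ [c1 ->] _ [c2 ->]|u u_s].
- by exists (fun=> 0); rewrite big1 // => k _; rewrite scale0r.
- exists (fun k => a * c1 k + c2 k); rewrite scaler_sumr -big_split.
  by apply: eq_bigr => k _; rewrite scalerA scalerDl.
have ltk: (index u s < size s)%N by rewrite index_mem.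
exists (fun k => (k == Ordinal ltk)%:R); rewrite (bigD1 (Ordinal ltk)) //= eqxx scale1r.
by rewrite nth_index // big1 ?addr0 // => k /negPf->; rewrite scale0r.
Qed.

Lemma fin_dimP W : fin_dim W <-> exists s, forall y, W y -> span (fun u => u \in s) y.
Proof.
split=> -[s Ws]; exists s => y /Ws; last exact: span_seq_comb.
move=> [c ->]; apply: subspace_sum; first exact: span_subspace.
move=> k _; apply: subspaceZ; first exact: span_subspace.
by apply: span_gen; rewrite mem_nth.
Qed.

(** Strong induction: the leading coefficient is invertible, so each term from index [(size p).-1]
    on is a combination of earlier ones. *)
Lemma shiftp_span (p : {poly C}) (X : nat -> V) : p != 0 ->
  (forall t, shiftp p X t = 0) ->
  forall r, span (fun y => exists2 l, (l < (size p).-1)%N & y = X l) (X r).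
Proof.
move=> p0 pX r; elim/ltn_ind: r => r IHr.
have [ltr|ler] := ltnP r (size p).-1; first by apply: span_gen; exists r.
(* At this index the top term of the recurrence is exactly [X r]. *)
have := pX (r - (size p).-1)%N.
rewrite (shiftp_widen (size p).-1.+1) ?leqSpred // big_ord_recr /= subnKC //.
move=> /eqP; rewrite addrC addr_eq0 => /eqP/(congr1 ( *:%R (lead_coef p)^-1)).
rewrite scalerA mulVf ?lead_coef_eq0 // scale1r => ->.
set s := span _; have sub : subspace s by apply: span_subspace.
apply: subspaceZ => //; rewrite -scaleN1r; apply: subspaceZ => //.
apply: subspace_sum => // l _; apply: subspaceZ => //; apply: IHr.
by rewrite -{2}(subnKC ler) ltn_add2r.
Qed.

Lemma fin_dim_recurrence W (X : nat -> V) :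
  fin_dim W -> (forall r, W (X r)) -> exists2 p : {poly C}, p != 0 & shiftp p X 0 = 0.
Proof.
move=> [s Ws] WX; pose N := size s.
have /fin_all_exists[c Xc] (r : 'I_N.+1) :
    exists c : 'I_N -> C, X r = \sum_k c k *: s`_k by apply: Ws.
pose M : 'M[C]_(N.+1, N) := \matrix_(r, k) c r k.
(* The [N.+1] rows of [M] live in dimension [N]; a nonzero row vector killing [M] supplies the
   coefficients of the polynomial. *)
have /rowV0Pn[u /sub_kermxP uM u_neq0] : kermx M != 0.
  rewrite -mxrank_eq0 mxrank_ker -lt0n subn_gt0.
  exact: leq_trans (rank_leq_col M) _.
exists (\poly_(r < N.+1) u 0 (inord r)).
  apply: contraNneq u_neq0 => p0; apply/eqP/rowP => r; rewrite mxE.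
  have := coef_poly N.+1 (fun r => u 0 (inord r)) r.
  by rewrite p0 coef0 ltn_ord inord_val.
rewrite (shiftp_widen N.+1) ?size_poly //.
under eq_bigr => r _.
  rewrite coef_poly ltn_ord inord_val addn0 Xc scaler_sumr; over.
rewrite exchange_big big1 // => k _.
have /matrixP/(_ 0 k) := uM; rewrite !mxE => uMk.
rewrite -[RHS](scale0r s`_k) -uMk scaler_suml.
by apply: eq_bigr => r _; rewrite mxE scalerA.
Qed.

End Span.

(** * Linear operators and independence of eigenvectors *)

Section LinOp.
Context {V : lmodType C} (g : V -> V) (gL : lin_op g).

Lemma lin_op0 : g 0 = 0.
Proof.
have := gL 1 0 0; rewrite !scale1r addr0 => /(congr1 (+%R^~ (- g 0))).
by rewrite addrK subrr => <-.
Qed.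

Lemma lin_opZ a u : g (a *: u) = a *: g u.
Proof. by have := gL a u 0; rewrite !addr0 lin_op0 addr0. Qed.

Lemma lin_opD u w : g (u + w) = g u + g w.
Proof. by have := gL 1 u w; rewrite !scale1r. Qed.

Lemma lin_op_sum (I : Type) (r : seq I) (P : pred I) (x : I -> V) :
  g (\sum_(i <- r | P i) x i) = \sum_(i <- r | P i) g (x i).
Proof. by rewrite (big_morph g lin_opD lin_op0). Qed.

Lemma shiftp_lin_op p X s : shiftp p (fun r => g (X r)) s = g (shiftp p X s).
Proof. by rewrite lin_op_sum; apply: eq_bigr => j _; rewrite lin_opZ. Qed.

Lemma subspace_preim W : subspace W -> subspace (fun u => W (g u)).
Proof. by move=> [W0 WL]; split=> [|a u w Wu Ww]; rewrite ?lin_op0 // gL; apply: WL. Qed.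

Lemma subspace_eigen a : subspace (fun u => g u = a *: u).
Proof.
split=> [|b u w gu gw]; first by rewrite lin_op0 scaler0.
by rewrite gL gu gw scalerDr !scalerA mulrC.
Qed.

(** Applying [g - a m] to a vanishing sum removes its last term and rescales the others by nonzero
    factors; induction on the length finishes. *)
Lemma eigen_sum_eq0 (a : nat -> C) (y : nat -> V) m :
  injective a -> (forall k, g (y k) = a k *: y k) ->
  \sum_(k < m) y k = 0 -> forall k, (k < m)%N -> y k = 0.
Proof.
move=> a_inj; elim: m y => [//|m IHm] y gy sum0 k.
have y0 l : (l < m)%N -> y l = 0.
  move=> ltlm; have : (a l - a m) *: y l = 0.
    apply: (IHm (fun k => (a k - a m) *: y k)) ltlm => [j|].
      by rewrite lin_opZ gy !scalerA mulrC.
    have : g (\sum_(k < m.+1) y k) - a m *: \sum_(k < m.+1) y k = 0.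
      by rewrite sum0 lin_op0 scaler0 subrr.
    rewrite lin_op_sum scaler_sumr -sumrB big_ord_recr /= gy subrr addr0 => E.
    by rewrite -[RHS]E; apply: eq_bigr => j _; rewrite gy scalerBl.
  move=> /eqP; rewrite scaler_eq0 subr_eq0 => /orP[/eqP/a_inj lm|/eqP//].
  by rewrite lm ltnn in ltlm.
rewrite ltnS leq_eqVlt => /orP[/eqP->|/y0//].
by move: sum0; rewrite big_ord_recr /= big1 ?add0r // => j _; apply: y0.
Qed.

(** The vectors [(a k - b) *: y k] are again eigenvectors and sum to zero, so each of them
    vanishes. *)
Lemma eigen_component_eq0 (a : nat -> C) (y : nat -> V) m b :
  injective a -> (forall k, g (y k) = a k *: y k) ->
  g (\sum_(k < m) y k) = b *: \sum_(k < m) y k ->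
  forall k, (k < m)%N -> a k != b -> y k = 0.
Proof.
move=> a_inj gy gsum k ltkm akb.
have : (a k - b) *: y k = 0.
  apply: (eigen_sum_eq0 a (fun k => (a k - b) *: y k)) ltkm => [//|j|].
    by rewrite lin_opZ gy !scalerA mulrC.
  have /eqP := gsum; rewrite -subr_eq0 lin_op_sum scaler_sumr -sumrB => /eqP E.
  by rewrite -[RHS]E; apply: eq_bigr => j _; rewrite gy scalerBl.
by move=> /eqP; rewrite scaler_eq0 subr_eq0 (negPf akb) => /eqP.
Qed.

End LinOp.

(** Positive definiteness makes [DA] invertible over the rationals, and [x] is the all-ones row
    times its inverse. The Cartan element with coordinates [x] takes the value 1 on every simple
    root. *)
Lemma cartan_dual_weight n (A : 'M[int]_n) d : simple_cartan A d ->
  exists x : 'I_n -> C, forall j, \sum_i x i * ((d i)%:Z * A i j)%:~R = 1.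
Proof.
move=> [_ [_ [_ [_ A_pos]]]].
pose B : 'M[rat]_n := \matrix_(i, j) ((d i)%:Z * A i j)%:~R.
have B_unit : B \in unitmx.
  rewrite -row_free_unit -kermx_eq0; apply/negPn/negP => /rowV0Pn[u].
  move=> /sub_kermxP uB u_neq0.
  have /A_pos : exists i, u 0 i != 0.
    apply/existsP; apply: contraNT u_neq0; rewrite negb_exists => /forallP u0.
    by apply/eqP/rowP => i; rewrite mxE; apply/eqP; have := u0 i; rewrite negbK.
  rewrite exchange_big big1 ?ltxx // => j _.
  rewrite -mulr_suml; have /matrixP/(_ 0 j) := uB; rewrite !mxE => uBj.
  have -> : \sum_i u 0 i * ((d i)%:Z * A i j)%:~R = 0.
    by rewrite -[RHS]uBj; apply: eq_bigr => i _; rewrite mxE.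
  by rewrite mul0r.
pose x : 'rV[rat]_n := const_mx 1 *m invmx B.
exists (fun i => ratr (x 0 i)) => j.
have /matrixP/(_ 0 j) : x *m B = const_mx 1 by rewrite mulmxKV.
rewrite !mxE => /(congr1 (@ratr C)); rewrite rmorph1 rmorph_sum => xB1.
by rewrite -[RHS]xB1; apply: eq_bigr => i _; rewrite rmorphM /= [B _ _]mxE ratr_int.
Qed.

(** * Levels: words of fixed length in the [f i r] *)

Section Levels.
Context {V : lmodType C} {n : nat} {A : 'M[int]_n} {d : 'I_n -> nat}.
Context {e h f : 'I_n -> nat -> V -> V}.
Hypothesis hV : yangian_module A d e h f.

Let c i j : C := ((d i)%:Z * A i j)%:~R.

Lemma e_lin i r : lin_op (e i r). Proof. by have [/(_ i r)[]] := hV. Qed.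
Lemma h_lin i r : lin_op (h i r). Proof. by have [/(_ i r)[_ []]] := hV. Qed.
Lemma f_lin i r : lin_op (f i r). Proof. by have [/(_ i r)[_ []]] := hV. Qed.

Lemma e_f i j r s u :
  e i r (f j s u) = f j s (e i r u) + (if i == j then h i (r + s)%N u else 0).
Proof.
have [_ [_ [/(_ i j r s u) E _]]] := hV.
by rewrite -E /comm addrC subrK.
Qed.

Lemma h0_e i j s u : h i 0%N (e j s u) = e j s (h i 0%N u) + c i j *: e j s u.
Proof.
have [_ [_ [_ [/(_ i j s u) E _]]]] := hV.
by rewrite -E /comm addrC subrK.
Qed.

Lemma h0_f i j s u : h i 0%N (f j s u) = f j s (h i 0%N u) - c i j *: f j s u.
Proof.
have [_ [_ [_ [_ [/(_ i j s u) E _]]]]] := hV.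
by rewrite -E /comm addrC subrK.
Qed.

(** Solved for [e h], the relation allows induction on [r] when showing that the [h i r] preserve
    vectors killed by all [e j s]. *)
Lemma e_hS i j r s u :
  e j s (h i r.+1 u) = h i r.+1 (e j s u) - comm (h i r) (e j s.+1) u
    - (c i j / 2) *: (h i r (e j s u) + e j s (h i r u)).
Proof.
have [_ [_ [_ [_ [_ [/(_ i j r s u) E _]]]]]] := hV.
move: (comm (h i r) _ _) E => w <-; by rewrite opprB addrA subrK subKr.
Qed.

(** All [h f] terms are put on the left and all [f h] terms on the right, matching the hypothesis of
    [shiftp_two_shifts]. *)
Lemma h_f_shift i j r s u :
  h i r.+1 (f j s u) - h i r (f j s.+1 u) + (c i j / 2) *: h i r (f j s u)
  = f j s (h i r.+1 u) - f j s.+1 (h i r u) - (c i j / 2) *: f j s (h i r u).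
Proof.
have [_ [_ [_ [_ [_ [_ [/(_ i j r s u) E _]]]]]]] := hV.
move: E; rewrite /comm scalerDr opprD addrACA -opprD => /eqP.
rewrite subr_eq => /eqP->; rewrite opprD addrAC.
by rewrite [X in X + _ + _]addrC subrK addrC.
Qed.

(** The base [S] is a parameter since two bases occur: the line through [v], and the singular
    vectors of a given level. *)
Fixpoint level (S : V -> Prop) (k : nat) : V -> Prop :=
  if k is k'.+1 then span (fun y => exists i r u, level S k' u /\ y = f i r u) else S.

Definition levels (S : V -> Prop) : V -> Prop :=
  span (fun y => exists k, level S k y).

Section Base.
Context {S : V -> Prop}.
Hypothesis (S_subspace : subspace S).

Lemma level_subspace k : subspace (level S k).
Proof. by case: k => // k; apply: span_subspace. Qed.

Lemma level_f k i r u : level S k u -> level S k.+1 (f i r u).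
Proof. by move=> Su; apply: span_gen; exists i, r, u. Qed.

Lemma level_min k (W : V -> Prop) : subspace W ->
  (forall i r u, level S k u -> W (f i r u)) -> forall y, level S k.+1 y -> W y.
Proof. by move=> sW fW; apply: span_min => // _ [i [r [u [Su ->]]]]; apply: fW. Qed.

Lemma levels_level k u : level S k u -> levels S u.
Proof. by move=> Su; apply: span_gen; exists k. Qed.

(** Allowing every length [M] above [m] lets two decompositions be padded to a common length and
    added. *)
Lemma levels_decomp y : levels S y -> exists (z : nat -> V) (m : nat),
  (forall k, level S k (z k)) /\ forall M, (m <= M)%N -> y = \sum_(k < M) z k.
Proof.
elim=> [|a u w _ [z1 [m1 [z1S uE]]] _ [z2 [m2 [z2S wE]]]|u [k Su]].
- exists (fun=> 0), 0%N; split=> [k|M _]; first by case: (level_subspace k).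
  by rewrite big1.
- exists (fun k => a *: z1 k + z2 k), (maxn m1 m2); split=> [k|M].
    by have [_ lS] := level_subspace k; apply: lS.
  rewrite geq_max => /andP[/uE u_sum /wE w_sum].
  by rewrite {1}u_sum {1}w_sum scaler_sumr big_split.
exists (fun j => if j == k then u else 0), k.+1; split=> [j|M ltkM].
  by case: eqP => [->//|_]; case: (level_subspace j).
rewrite (bigD1 (Ordinal ltkM)) //= eqxx big1 ?addr0 // => j.
by rewrite -val_eqE => /negPf /= ->.
Qed.

Hypothesis (S_h : forall i r u, S u -> S (h i r u)).

(** Induction on [k], then on [r] for all [s] at once: the relation between [h] and [f] lowers [r]
    at the price of raising [s]. *)
Lemma level_h k i r u : level S k u -> level S k (h i r u).
Proof.
elim: k i r u => [|k IHk] i r u; first exact: S_h.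
have sub := level_subspace k.+1.
move: u; apply: level_min; first by apply: subspace_preim => //; apply: h_lin.
move=> j s u Su; elim: r s => [|r IHr] s.
  by rewrite h0_f; apply: subspaceB => //; last apply: subspaceZ => //;
     apply: level_f => //; apply: IHk.
have -> : h i r.+1 (f j s u) = h i r (f j s.+1 u) - (c i j / 2) *: h i r (f j s u)
     + (f j s (h i r.+1 u) - f j s.+1 (h i r u) - (c i j / 2) *: f j s (h i r u)).
  by rewrite -h_f_shift addrC addrACA subrK subrr addr0.
have Sf t w : level S k w -> level S k.+1 (f j t w) by apply: level_f.
apply: subspaceD => //; apply: subspaceB => //; try by apply: subspaceZ; auto.
by apply: subspaceB => //; apply: Sf; apply: IHk.
Qed.

Hypothesis (S_e : forall i r u, S u -> e i r u = 0).

(** Moving [e] past the leftmost [f] leaves a shorter word hit by [e], or an [h] acting on a vector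
    of level [k]. *)
Lemma level_e k i r u : level S k.+1 u -> level S k (e i r u).
Proof.
elim: k u => [|k IHk]; apply: level_min;
  try (by apply: subspace_preim; [apply: e_lin | apply: level_subspace]);
  move=> j s u Su; rewrite e_f; apply: subspaceD; try exact: level_subspace.
- by rewrite S_e // (lin_op0 _ (f_lin _ _)); case: (level_subspace 0).
- by case: ifP => _; [apply: level_h | case: (level_subspace 0)].
- by apply: level_f; apply: IHk.
by case: ifP => _; [apply: level_h | case: (level_subspace k.+1)].
Qed.

Lemma levels_submodule : submodule e h f (levels S).
Proof.
have sub : subspace (levels S) by apply: span_subspace.
have [W0 WL] := sub; split=> //; split=> // i r u Wu.
have ind g : lin_op g -> (forall k w, level S k w -> levels S (g w)) -> levels S (g u).
  move=> gL gS; move: u Wu; apply: span_min; first exact: subspace_preim.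
  by move=> w [k]; apply: gS.
split; [|split].
- apply: ind (e_lin i r) _ => -[w Sw|k w Sw]; first by rewrite S_e.
  by apply: (levels_level k); apply: level_e.
- apply: ind (h_lin i r) _ => k w Sw.
  by apply: (levels_level k); apply: level_h.
apply: ind (f_lin i r) _ => k w Sw.
by apply: (levels_level k.+1); apply: level_f.
Qed.

End Base.

(** * Grading of an irreducible highest weight module *)

Section HighestWeight.
Context {mu : 'I_n -> nat -> C} {v : V} {x : 'I_n -> C}.
Hypothesis hv : highest_weight_vector e h mu v.
Hypothesis hirr : irreducible e h f.
Hypothesis x_dual : forall j, \sum_i x i * c i j = 1.

(* [degree_op] has weight [-1] on every [f j s], so it grades [V] by the length
   of monomials in the [f j s]. *)
Let degree_op (u : V) : V := \sum_i x i *: h i 0%N u.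

Lemma degree_op_lin : lin_op degree_op.
Proof.
move=> a u w; rewrite /degree_op scaler_sumr -big_split; apply: eq_bigr => i _.
by rewrite h_lin scalerDr !scalerA mulrC.
Qed.

Lemma degree_op_f j s u : degree_op (f j s u) = f j s (degree_op u) - f j s u.
Proof.
rewrite /degree_op (lin_op_sum _ (f_lin j s)) -[X in _ = _ - X]scale1r -(x_dual j).
rewrite scaler_suml -sumrB; apply: eq_bigr => i _.
by rewrite h0_f scalerBr scalerA (lin_opZ _ (f_lin j s)).
Qed.

Lemma level_degree (S : V -> Prop) a :
  (forall u, S u -> degree_op u = a *: u) ->
  forall k u, level S k u -> degree_op u = (a - k%:R) *: u.
Proof.
move=> Sa; elim=> [|k IHk] u; first by move=> /Sa->; rewrite subr0.
move: u; apply: level_min => [|j s u /IHk uk].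
  by apply: subspace_eigen; apply: degree_op_lin.
rewrite degree_op_f uk (lin_opZ _ (f_lin j s)) -natr1 opprD addrA [RHS]scalerBl.
by rewrite scale1r.
Qed.

Lemma degree_inj (a : C) : injective (fun k : nat => a - k%:R).
Proof. by move=> k l /addrI/oppr_inj/eqP; rewrite eqr_nat => /eqP. Qed.

Let line (u : V) : Prop := exists b : C, u = b *: v.

Lemma line_subspace : subspace line.
Proof.
split=> [|a _ _ [b1 ->] [b2 ->]]; first by exists 0; rewrite scale0r.
by exists (a * b1 + b2); rewrite scalerA scalerDl.
Qed.

Lemma line_e i r u : line u -> e i r u = 0.
Proof.
by have [_ [ev _]] := hv; move=> [b ->]; rewrite (lin_opZ _ (e_lin i r)) ev scaler0.
Qed.

Lemma line_h_eigen i r u : line u -> h i r u = mu i r *: u.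
Proof.
have [_ [_ hve]] := hv; move=> [b ->].
by rewrite (lin_opZ _ (h_lin i r)) hve !scalerA mulrC.
Qed.

Lemma line_h i r u : line u -> line (h i r u).
Proof.
by move=> lu; rewrite line_h_eigen //; apply: subspaceZ; first exact: line_subspace.
Qed.

(** The levels over [line] form a submodule containing [v], so irreducibility makes it
    everything. *)
Lemma levels_line_full u : levels line u.
Proof.
have [_ /(_ (levels line))] := hirr; case.
- by apply: levels_submodule; [exact: line_subspace | exact: line_h | exact: line_e].
- have [v0 _] := hv; move=> /(_ v) v_eq0; case/eqP: v0; apply: v_eq0.
  by apply: (levels_level 0); exists 1; rewrite scale1r.
exact.
Qed.

Let lambda : C := \sum_i x i * mu i 0%N.

Lemma line_degree u : line u -> degree_op u = lambda *: u.
Proof.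
move=> lu; rewrite /degree_op /lambda scaler_suml; apply: eq_bigr => i _.
by rewrite line_h_eigen // scalerA.
Qed.

(* Singular vectors of positive degree generate a submodule missing [v]. *)
Lemma singular_eq0 k y : level line k.+1 y -> (forall i r, e i r y = 0) -> y = 0.
Proof.
move=> yk ey; pose S u := level line k.+1 u /\ forall i r, e i r u = 0.
have S_subspace : subspace S.
  have [l0 lL] := @level_subspace line line_subspace k.+1.
  split=> [|a u w [uk eu] [wk ew]].
    by split=> // i r; rewrite (lin_op0 _ (e_lin i r)).
  by split=> [|i r]; [exact: lL | rewrite e_lin eu ew scaler0 addr0].
have S_h i r u : S u -> S (h i r u).
  move=> [uk eu]; split; first exact: (level_h line_subspace line_h).
  elim: r => [|r IHr] j s.
    have := h0_e i j s u; rewrite eu (lin_op0 _ (h_lin _ _)) scaler0 addr0.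
    by move=> <-.
  rewrite e_hS /comm !eu !IHr !(lin_op0 _ (h_lin _ _)).
  by rewrite !subr0 addr0 scaler0 subr0.
have S_e i r u : S u -> e i r u = 0 by case.
have [_ /(_ (levels S) (levels_submodule S_subspace S_h S_e))] := hirr.
case=> [/(_ y) -> //|/(_ v) Sv]; first by apply: (levels_level 0).
have [v_neq0 _] := hv; case/eqP: v_neq0.
have [z [m [zS /(_ _ (leqnn m)) vz]]] := levels_decomp S_subspace _ Sv.
(* The components of [v] would have degrees [lambda - k.+1 - l], never equal to the degree [lambda]
   of [v], so all would vanish. *)
have z_degree l : degree_op (z l) = (lambda - k.+1%:R - l%:R) *: z l.
  apply: level_degree (zS l) => u [uk _].
  exact: (level_degree line _ line_degree).
have v_degree : degree_op v = lambda *: v.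
  by apply: line_degree; exists 1; rewrite scale1r.
rewrite vz big1 // => l _; move: v_degree; rewrite vz.
move=> /(eigen_component_eq0 _ degree_op_lin _ _ _ _ (degree_inj _) z_degree).
apply=> //; rewrite -addrA -opprD -natrD -subr_eq0 addrAC subrr add0r.
by rewrite oppr_eq0 pnatr_eq0.
Qed.

(** * Recurrences for [h] and [f] on each level *)

Definition h_recurrence k : Prop := exists2 q : {poly C}, q != 0 &
  forall i w, level line k w -> forall s, shiftp q (fun r => h i r w) s = 0.

(** As in [h_recurrence], one polynomial serves every index [i] and every vector of the level; this
    later bounds [r] uniformly. *)
Definition f_recurrence k : Prop := exists2 p : {poly C}, p != 0 &
  forall i w, level line k w -> forall s, shiftp p (fun r => f i r w) s = 0.

(** Applying [e j t] to the [q * p] combination of the [f i r w] gives a term killed by [p] and, if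
    [i = j], a combination of the [h j (t + r) w] killed by [q]. The result is singular of positive
    level, hence zero. *)
Lemma f_recurrence_of_h k : h_recurrence k ->
  (exists2 p : {poly C}, p != 0 & forall i j t w, level line k w ->
     forall s, shiftp p (fun r => f i r (e j t w)) s = 0) -> f_recurrence k.
Proof.
move=> [q q0 hq] [p p0 fp]; exists (q * p); first by rewrite mulf_neq0.
move=> i w wk s; apply: (singular_eq0 k) => [|j t].
  apply: subspace_sum; first exact: span_subspace.
  move=> l _; apply: subspaceZ; first exact: span_subspace.
  exact: level_f.
rewrite -(shiftp_lin_op _ (e_lin j t)).
under eq_shiftp => r do rewrite e_f.
rewrite shiftp_addr shiftpM_eq0 ?add0r; last by move=> ?; apply: fp.
case: eqP => _; last by rewrite shiftp_eq0.
(* The extra [t] in the index of [h] is absorbed by evaluating the recurrence at [s + t]. *)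
rewrite mulrC -(shiftpM_eq0 p q (fun r => h j r w) (hq j w wk) (s + t)%N).
by apply: eq_bigr => l _; rewrite addnC addnA.
Qed.

Lemma h_recurrenceS k : h_recurrence k -> f_recurrence k -> h_recurrence k.+1.
Proof.
move=> [q q0 hq] [p p0 fp].
(* [shiftp_two_shifts] yields a factor depending on [c i j]; the product over all pairs makes the
   recurrence uniform. *)
pose p_ (ij : 'I_n * 'I_n) := p \Po ('X + (c ij.1 ij.2 / 2)%:P).
exists (q * \prod_ij p_ ij).
  rewrite mulf_neq0 //; apply/prodf_neq0 => ij _.
  by rewrite -size_poly_eq0 size_comp_poly2 ?size_XaddC // size_poly_eq0.
move=> i w wk s; move: w wk s; apply: level_min.
  split=> [s|a u w hu hw s].
    by rewrite shiftp_eq0 // => r; rewrite (lin_op0 _ (h_lin _ _)).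
  under eq_shiftp => r do rewrite h_lin.
  by rewrite shiftp_addr shiftp_scaler hu hw scaler0 addr0.
move=> j t u uk.
have key r : shiftp (q * p_ (i, j)) (fun r => h i r (f j t u)) r = 0.
  apply: (shiftp_two_shifts _ _ _ (fun r s => h i r (f j s u))
    (fun r s => f j s (h i r u))) => [r' s'|r' s'|r' s'].
  - exact: h_f_shift.
  - by rewrite (shiftp_lin_op _ (f_lin _ _)) hq // (lin_op0 _ (f_lin _ _)).
  by rewrite (shiftp_lin_op _ (h_lin _ _)) fp // (lin_op0 _ (h_lin _ _)).
by rewrite (bigD1 (i, j)) //= mulrA mulrC; apply: shiftpM_eq0.
Qed.

(** At level 0 the [e j t] kill everything, so [p = 1] serves; afterwards [e j t] drops to the
    previous level, where the recurrence for [f] is known. *)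
Lemma recurrences : h_recurrence 0 -> forall k, h_recurrence k /\ f_recurrence k.
Proof.
move=> h0; elim=> [|k [hk fk]].
  split=> //; apply: f_recurrence_of_h => //; exists 1; first exact: oner_neq0.
  move=> i j t w /line_e-> s; rewrite shiftp_eq0 // => r.
  exact: (lin_op0 _ (f_lin _ _)).
have hk1 := h_recurrenceS k hk fk; split=> //; apply: f_recurrence_of_h => //.
have [p p0 fp] := fk; exists p => // i j t w wk; apply: fp.
exact: (level_e line_subspace line_h line_e).
Qed.

(** * Finite dimension of levels and weight spaces *)

Lemma fin_dim_level : (forall k, f_recurrence k) -> forall k, fin_dim (level line k).
Proof.
move=> f_rec; elim=> [|k /fin_dimP[s s_span]]; apply/fin_dimP.
  exists [:: v] => _ [b ->]; apply: subspaceZ; first exact: span_subspace.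
  by apply: span_gen; rewrite mem_head.
have [p p0 fp] := f_rec k.
(* Below the order of the recurrence only finitely many [r] remain, and [u] runs over a finite
   spanning set of level [k]. *)
pose G := [seq f ir.1 ir.2 u | ir <- [seq (i, r) | i <- enum 'I_n, r <- iota 0 (size p).-1],
                              u <- s].
exists G; apply: level_min => [|i r u uk]; first exact: span_subspace.
have := shiftp_span p _ p0 (fp i u uk) r; move: (f i r u).
apply: span_min => [|_ [l ltl ->]]; first exact: span_subspace.
move: (s_span u uk) => {uk}; move: u; apply: span_min => [|u us].
  by apply: subspace_preim; [exact: f_lin | exact: span_subspace].
apply: span_gen; apply/allpairsP; exists ((i, l), u); split=> //.
by apply/allpairsP; exists (i, l); rewrite mem_enum mem_iota.
Qed.

Lemma fin_dim_weight_space eta : (forall k, fin_dim (level line k)) ->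
  fin_dim (weight_space h eta).
Proof.
move=> fin_level; pose kappa := \sum_i x i * eta i.
have degree_eta y : weight_space h eta y -> degree_op y = kappa *: y.
  move=> y_eta; rewrite /degree_op /kappa scaler_suml; apply: eq_bigr => i _.
  by rewrite y_eta scalerA.
have comp_eq0 y : weight_space h eta y -> exists (z : nat -> V) (m : nat),
    [/\ forall k, level line k (z k), y = \sum_(k < m) z k &
        forall k, (k < m)%N -> lambda - k%:R != kappa -> z k = 0].
  move=> y_eta; have [z [m [zk /(_ m (leqnn m)) yz]]] :=
    levels_decomp line_subspace _ (levels_line_full y).
  exists z, m; split=> //; have := degree_eta y y_eta; rewrite yz.
  apply: eigen_component_eq0 => //; first exact: degree_op_lin.
    exact: degree_inj.
  by move=> k; apply: (level_degree line _ line_degree).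
(* At most one level has degree [kappa]; if none does, the weight space is zero and the empty list
   spans it. *)
have [[k kE]|no_k] := classic (exists k : nat, lambda - k%:R = kappa).
  have [s s_span] := fin_level k; exists s => y /comp_eq0[z [m [zk yz z0]]].
  apply: s_span; rewrite yz; apply: subspace_sum.
    exact: level_subspace line_subspace k.
  move=> l _; have [->|nlk] := eqVneq (nat_of_ord l) k; first exact: zk.
  rewrite z0 //; first by case: (@level_subspace line line_subspace k).
  by rewrite -kE; apply: contraNneq nlk => /degree_inj->.
exists [::] => y /comp_eq0[z [m [_ yz z0]]].
exists (fun=> 0); rewrite big1 => [|i _]; last by rewrite scale0r.
rewrite yz big1 // => l _; apply: z0 => //; apply/eqP => lE.
by apply: no_k; exists l.
Qed.

(** * Recurrences for the highest weight series *)

Lemma h_recurrence0 : (forall i, exists2 q : {poly C}, q != 0 &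
    forall s, \sum_(j < size q) q`_j * mu i (j + s)%N = 0) -> h_recurrence 0.
Proof.
move=> /fin_all_exists2[q q0 qmu]; exists (\prod_i q i).
  by apply/prodf_neq0 => i _; apply: q0.
move=> i w lw; apply: (shiftp_prod_eq0 _ _ i) => s.
rewrite -(scale0r w) -(qmu i s) scaler_suml; apply: eq_bigr => j _.
by rewrite line_h_eigen // scalerA.
Qed.

(** All [f i r v] share one weight, so they satisfy a dependence at shift 0. Since [e i s (f i r v)]
    equals [mu i (r + s) *: v], applying [e i s] spreads it to every shift [s]. *)
Lemma mu_recurrence i : (forall eta, fin_dim (weight_space h eta)) ->
  exists2 q : {poly C}, q != 0 &
    forall s, \sum_(j < size q) q`_j * mu i (j + s)%N = 0.
Proof.
move=> fin_wt; have lv : line v by exists 1; rewrite scale1r.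
have [q q0 qf] : exists2 q : {poly C}, q != 0 & shiftp q (fun r => f i r v) 0 = 0.
  apply: fin_dim_recurrence (fin_wt (fun j => mu j 0%N - c j i)) _ => r j.
  by rewrite h0_f line_h_eigen // (lin_opZ _ (f_lin _ _)) scalerBl.
exists q => // s; have [v_neq0 _] := hv.
have : e i s (shiftp q (fun r => f i r v) 0) = 0 by rewrite qf (lin_op0 _ (e_lin _ _)).
rewrite -(shiftp_lin_op _ (e_lin i s)) /shiftp.
under eq_bigr => r _.
  rewrite e_f eqxx line_e // (lin_op0 _ (f_lin _ _)) add0r line_h_eigen //.
  rewrite scalerA addn0 addnC; over.
by rewrite -scaler_suml => /eqP; rewrite scaler_eq0 (negPf v_neq0) orbF => /eqP.
Qed.

End HighestWeight.

End Levels.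

(** [Q] is [q] made monic and [P] is the polynomial part of [Q] times the series. The constant term
    1 of the series makes [P] monic of the same degree. *)
Lemma laurent_expansion_of_recurrence n (mu : 'I_n -> nat -> C) i (q : {poly C}) :
  q != 0 -> (forall s, \sum_(j < size q) q`_j * mu i (j + s)%N = 0) ->
  exists P Q : {poly C}, P \is monic /\ Q \is monic /\ size P = size Q /\
    laurent_expansion (mu_series mu i) P Q.
Proof.
move=> q0 qmu; pose Q := (lead_coef q)^-1 *: q.
have lc0 : (lead_coef q)^-1 != 0 by rewrite invr_eq0 lead_coef_eq0.
have Q_monic : Q \is monic.
  by rewrite monicE lead_coefZ mulVf // lead_coef_eq0.
have sQ : size Q = size q by rewrite size_scale.
have sQ_gt0 : (0 < size Q)%N by rewrite sQ size_poly_gt0.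
pose E m := \sum_(m <= j < size Q) Q`_j * mu_series mu i (j - m)%N.
have E_lead : E (size Q).-1 = 1.
  rewrite /E -{2}(prednK sQ_gt0) big_nat1 subnn mulr1.
  exact: (monicP Q_monic).
pose P := \poly_(m < size Q) E m.
have sP : size P = size Q.
  by apply: size_poly_eq; rewrite E_lead oner_neq0.
exists P, Q; do ?split=> //.
- by rewrite monicE lead_coefE sP coef_poly prednK // leqnn E_lead.
- move=> m; rewrite coef_poly; case: ltnP => // le_m.
  by rewrite big_geq.
case=> // t _; rewrite sQ.
have scaled_qmu := congr1 ( *%R (lead_coef q)^-1) (qmu t).
rewrite mulr0 mulr_sumr in scaled_qmu; rewrite -[RHS]scaled_qmu.
by apply: eq_bigr => j _; rewrite coefZ addnS mulrA.
Qed.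

Theorem theorem1p2 (n : nat) (A : 'M[int]_n) (d : 'I_n -> nat)
  (hA : simple_cartan A d)
  (mu : 'I_n -> nat -> C)
  (V : lmodType C) (e h f : 'I_n -> nat -> V -> V)
  (hV : yangian_module A d e h f)
  (v : V) (hv : highest_weight_vector e h mu v)
  (hirr : irreducible e h f) :
  (forall eta : 'I_n -> C, fin_dim (weight_space h eta)) <->
  (forall i : 'I_n, exists P Q : {poly C},
     P \is monic /\ Q \is monic /\ size P = size Q /\
     laurent_expansion (mu_series mu i) P Q).
Proof.
split=> [fin_wt i|mu_rat eta].
  have [q q0 qmu] := mu_recurrence hV hv i fin_wt.
  exact: laurent_expansion_of_recurrence q0 qmu.
have [x x_dual] := cartan_dual_weight _ _ _ hA.
apply: (fin_dim_weight_space hV hv hirr x_dual) => k.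
apply: (fin_dim_level hV) => {}k.
(* Vanishing of the coefficient of [u^-(s+1)] in [Q] times the series is the recurrence at [s],
   because [mu i k] is the coefficient of [u^-(k+1)]. *)
have [] // := recurrences hV hv hirr x_dual _ k.
apply: (h_recurrence0 hV hv) => i; have [P [Q [_ [Q_monic [_ [_ Qmu]]]]]] := mu_rat i.
exists Q; first exact: monic_neq0.
by move=> s; rewrite -[RHS](Qmu s.+1) //; apply: eq_bigr => j _; rewrite addnS.
Qed.
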